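(* Let $q\geq 2$ be an integer which is not a power of $2$ and not a power of $3$ (i.e. $q\neq 2^n,3^n$ for every positive integer $n$). Then there exists an integer $a$ with $1\leq a<q$ and $\gcd(a,q)=1$ such that $K(a/q)\leq \operatorname{rad}(q)-1$.
   Context: Every rational number $a/q\in(0,1)$ has a finite simple continued fraction expansion $a/q=[a_1,\ldots,a_r]=\cfrac{1}{a_1+\cfrac{1}{a_2+\cdots+\cfrac{1}{a_r}}}$ with positive integers $a_i$, taken with $a_r\geq 2$ (when $r\geq1$ and $a/q\neq 1$). Define $K(a/q)=\max(a_1,\ldots,a_r)$. For a positive integer $n$, $\operatorname{rad}(n)$ denotes the product of the distinct prime numbers dividing $n$. *)

(* Defs.v *)
From mathcomp Require Import all_boot all_order all_algebra.
From mathcomp Require Import zify ring lra.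
Set Implicit Arguments.
Unset Strict Implicit.
Unset Printing Implicit Defensive.
Import Order.TTheory GRing.Theory Num.Theory.
Local Open Scope ring_scope.

Definition cf_value (s : seq nat) : rat := foldr (fun n x => (n%:R + x)^-1) 0 s.

(* [last 0 s >= 2] also forces [s] to be nonempty. *)
Definition is_cf (x : rat) (s : seq nat) : bool :=
  [&& all (leq 1) s, (2 <= last 0%N s)%N & cf_value s == x].

Lemma cf_exists_nat (q a : nat) :
  (0 < a < q)%N -> exists s, is_cf (a%:R / q%:R) s.
Proof.
elim/ltn_ind: q a => q IH a /andP[a0 aq].
have qE := divn_eq q a.
have aN0 : (a%:R : rat) != 0 by rewrite pnatr_eq0 -lt0n.
have d0 : (0 < q %/ a)%N by rewrite divn_gt0 // ltnW.
have [r0|r0] := posnP (q %% a)%N.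
  exists [:: (q %/ a)%N]; rewrite /is_cf /= d0 /= addr0; apply/andP; split.
    by move: qE d0; rewrite r0 addn0; case: (q %/ a)%N => [|[|n]] //; lia.
  by apply/eqP; rewrite {2}qE r0 addn0 natrM invfM mulrCA mulfV ?mulr1.
have [||s /and3P[s1 s2 /eqP s3]] := IH a _ (q %% a)%N; first exact: aq.
  by rewrite r0 ltn_mod.
exists ((q %/ a)%N :: s); rewrite /is_cf /= d0 s1 s3 /=; apply/andP; split.
  by case: s s2 {s1 s3}.
apply/eqP; have -> : (q%:R : rat) = (q %/ a)%:R * a%:R + (q %% a)%:R.
  by rewrite -natrM -natrD -qE.
by rewrite -[in RHS]invf_div mulrDl mulfK.
Qed.

Lemma cf_exists (x : rat) : 0 < x < 1 -> exists s, is_cf x s.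
Proof.
move=> /andP[x0 x1].
have n0 : 0 < numq x by rewrite numq_gt0.
have nE : numq x = `|numq x|%N :> int by rewrite gez0_abs ?ltW.
have dE : denq x = `|denq x|%N :> int by rewrite gez0_abs ?denq_ge0.
have xE : x = `|numq x|%N%:R / `|denq x|%N%:R.
  by rewrite -{1}(divq_num_den x) {1}nE {1}dE.
have lt : numq x < denq x.
  have : (numq x)%:~R / (denq x)%:~R < 1 :> rat by rewrite divq_num_den.
  by rewrite ltr_pdivrMr ?ltr0z ?denq_gt0 // mul1r ltr_int.
by rewrite xE; apply: cf_exists_nat; lia.
Qed.

(* The expansion [a_1; ...; a_r] of [x] in (0, 1); junk value [::] elsewhere. *)
Definition cf (x : rat) : seq nat :=
  if decP (@idP (0 < x < 1)) is left h then xchoose (cf_exists h) else [::].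

Definition K (x : rat) : nat := (\max_(n <- cf x) n)%N.

Definition radn (n : nat) : nat := (\prod_(p <- primes n) p)%N.

Lemma cfP (x : rat) : 0 < x < 1 -> is_cf x (cf x).
Proof. by rewrite /cf => hx; case: decP => // h; apply: xchooseP. Qed.

Lemma cf_value_itv (s : seq nat) :
  all (leq 1) s -> (2 <= last 0%N s)%N -> 0 < cf_value s < 1.
Proof.
elim: s => //= n s IH /andP[n1 s1] l2.
have n1' : (1 : rat) <= n%:R by rewrite ler1n.
suff h : 1 < n%:R + cf_value s by rewrite invr_gt0 invf_lt1 ?h ?andbT; lra.
case: s IH s1 l2 => [|m s] IH s1 l2 /=; first by rewrite addr0 ltr1n.
by have /andP[] := IH s1 l2; rewrite /=; lra.
Qed.

Lemma natrD_uniq (m n : nat) (x y : rat) :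
  0 <= x < 1 -> 0 <= y < 1 -> n%:R + x = m%:R + y -> n = m.
Proof.
move=> /andP[x0 x1] /andP[y0 y1] e.
by case: (ssrnat.ltngtP n m) => //; rewrite -(ler_nat rat) -natr1 => h; exfalso; lra.
Qed.

Lemma is_cf_uniq (x : rat) (s t : seq nat) : is_cf x s -> is_cf x t -> s = t.
Proof.
move=> /and3P[+ + /eqP<-] /and3P[+ + /eqP/esym].
have cv0 u n : all (leq 1) u -> (2 <= last n u)%N -> 0 <= cf_value u < 1.
  by case: u => [|m u] // h1 h2; have /andP[/ltW-> ->] := @cf_value_itv (m :: u) h1 h2.
elim: s t => [|n s IH] [|m t] // /andP[n1 s1] l2 /andP[m1 t1] l2' /invr_inj e.
have nm := natrD_uniq (cv0 _ _ s1 l2) (cv0 _ _ t1 l2') e.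
move: e; rewrite nm => /addrI e; congr cons.
change (cf_value s = cf_value t) in e.
case: s t s1 t1 l2 l2' e IH => [|a s] [|b t] s1 t1 l2 l2' e IH.
- by [].
- by have := @cf_value_itv (b :: t) t1 l2'; rewrite -e ltxx.
- by have := @cf_value_itv (a :: s) s1 l2; rewrite e ltxx.
- exact: IH.
Qed.

(* Main.v *)
Require Import Defs.
From mathcomp Require Import all_boot all_order all_algebra.
From mathcomp Require Import zify ring.
Set Implicit Arguments.
Unset Strict Implicit.
Import GRing.Theory Num.Theory.
Local Open Scope nat_scope.

(** If [a_1, ..., a_n, d] has denominator [q], then
    [a_1, ..., a_n, d, x - 1, 1, d - 1, a_n, ..., a_1] has denominator
    [x * q ^ 2]; for [x = 1] the middle part collapses to [d + 1, d - 1].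
    Every [q] is [x * m ^ 2] with [x] squarefree, so [x <= rad q], and this
    folding turns an expansion for [m] into one for [q].  Since [rad m] may be
    smaller than [rad q], the induction on [q] fixes a bound [R] divisible by
    the primes of [q]; it keeps the first and last quotients between [2] and
    [R - 2], so that the new quotients [d - 1] and [d + 1] are again allowed.
    Two or more quotients, the first and the last at least [2], form a fraction
    [a / q] with [1 < a < q / 2]; for [q = 1, 2, 3, 4, 6], where the totient is
    at most [2], there is none.  Hence the induction starts from squarefree [q]
    and from [m = 2, 3, 4, 6], where explicit expansions are available. *)

Implicit Types (n d m p q x R : nat) (s t u : seq nat) (v w : nat * nat).

(* Multiplication of the column [v] by [[n, 1], [1, 0]], which is symmetric. *)
Definition cf_step n v : nat * nat := (n * v.1 + v.2, v.1).

Definition cf_act s v : nat * nat := foldr cf_step v s.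

Definition cf_den s : nat := (cf_act s (1, 0)).1.
Definition cf_num s : nat := (cf_act s (1, 0)).2.

Definition dot v w : nat := v.1 * w.1 + v.2 * w.2.

Lemma dot_cf_act s v w : dot (cf_act s v) w = dot v (cf_act (rev s) w).
Proof.
elim: s w => //= n s IH w; rewrite rev_cons /cf_act foldr_rcons -IH.
by rewrite /dot /cf_step /=; ring.
Qed.

Lemma cf_den_cat s t :
  cf_den (s ++ t) = dot (cf_act (rev s) (1, 0)) (cf_act t (1, 0)).
Proof.
by rewrite dot_cf_act revK /cf_act -foldr_cat /dot /cf_den mul1n mul0n addn0.
Qed.

Lemma cf_den_gt0 s : all (leq 1) s -> 0 < cf_den s.
Proof.
elim: s => //= n s IH /andP[n_gt0 /IH].
by rewrite /cf_den /= addn_gt0 muln_gt0 n_gt0 => ->.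
Qed.

Lemma coprime_cf_num_den s : coprime (cf_num s) (cf_den s).
Proof.
elim: s => //= n s; rewrite /cf_num /cf_den /= => IH.
by rewrite /coprime gcdnMDl gcdnC.
Qed.

Lemma cf_num_itv s : all (leq 1) s -> 1 < last 0 s -> 0 < cf_num s < cf_den s.
Proof.
elim: s => // n s IH /= /andP[n_gt0 s_gt0] s_last.
have den_gt0 := cf_den_gt0 s_gt0.
rewrite [cf_num _]/(cf_den s) [cf_den (n :: s)]/(n * cf_den s + cf_num s).
rewrite den_gt0.
case: s IH s_gt0 s_last {den_gt0} => [|m s] IH s_gt0 s_last.
  by move: s_last; rewrite /cf_den /cf_num /=; lia.
have /andP[num_gt0 _] := IH s_gt0 s_last.
by rewrite /= -addn1 leq_add ?leq_pmull.
Qed.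

Lemma cf_value_num_den s : all (leq 1) s ->
  cf_value s = ((cf_num s)%:R / (cf_den s)%:R)%R.
Proof.
elim: s => [|n s IH] /= => [_|/andP[_ s_gt0]]; first by rewrite mul0r.
have den_neq0 : ((cf_den s)%:R != 0 :> rat)%R.
  by rewrite pnatr_eq0 -lt0n cf_den_gt0.
rewrite IH // -[RHS]invf_div; congr (_^-1)%R.
by rewrite /cf_den /= natrD natrM mulrDl mulfK.
Qed.

Lemma is_cf_num_den s : all (leq 1) s -> 1 < last 0 s ->
  is_cf ((cf_num s)%:R / (cf_den s)%:R)%R s.
Proof.
by move=> s_gt0 s_last; rewrite /is_cf s_gt0 s_last cf_value_num_den /=.
Qed.

Lemma K_is_cf (r : rat) s : is_cf r s -> K r = \max_(n <- s) n.
Proof.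
move=> cf_s; have /and3P[s_gt0 s_last /eqP sE] := cf_s.
have /cfP cf_r : (0 < r < 1)%R by rewrite -sE cf_value_itv.
by rewrite /K (is_cf_uniq cf_r cf_s).
Qed.

Definition cf_fold x u d : seq nat :=
  u ++ (if x is y.+2 then [:: d; y.+1; 1; d.-1] else [:: d.+1; d.-1]) ++ rev u.

Lemma cf_den_fold x u d : 0 < x -> 0 < d ->
  cf_den (cf_fold x u d) = x * cf_den (rcons u d) ^ 2.
Proof.
case: d => // d.
rewrite -cats1 /cf_fold !cf_den_cat /cf_act foldr_cat -/(cf_act _ _).
case: (cf_act (rev u) _) => a b; rewrite /dot.
by case: x => [|[|x]] //= _ _; ring.
Qed.

Definition admissible R s : bool :=
  [&& 1 < size s, all (fun n => 0 < n < R) s,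
      1 < head 0 s < R.-1 & 1 < last 0 s < R.-1].

Definition admissible_den R q : Prop :=
  exists2 s, admissible R s & cf_den s = q.

Lemma admissible_fold R x u d : 0 < x <= R ->
  admissible R (rcons u d) -> admissible R (cf_fold x u d).
Proof.
move=> x_itv; rewrite /admissible last_rcons.
case: u => [|n u] //= /and4P[_ + n_itv d_itv].
rewrite all_rcons => /and3P[nR _ uR].
rewrite /cf_fold !size_cat size_rev !all_cat all_rev /= nR uR n_itv.
rewrite rev_cons -!rcons_cat last_rcons n_itv.
by case: x x_itv => [|[|x]] /=; lia.
Qed.

Lemma admissible_den_fold R x q : 0 < x <= R ->
  admissible_den R q -> admissible_den R (x * q ^ 2).
Proof.
move=> x_itv [s + <-]; case/lastP: s => [|u d] // adm.
exists (cf_fold x u d); first exact: admissible_fold.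
have /and4P[_ _ _] := adm; rewrite last_rcons => d_itv.
by rewrite cf_den_fold; lia.
Qed.

Lemma admissible_den_fold1 R x d : 1 < x <= R -> 2 < d < R.-1 ->
  admissible_den R (x * d ^ 2).
Proof.
move=> x_itv d_itv; exists (cf_fold x [::] d).
  by case: x x_itv => [|[|x]] //=; rewrite /admissible /=; lia.
by rewrite cf_den_fold /cf_den /=; lia.
Qed.

Lemma K_admissible_den R q : admissible_den R q ->
  exists a, [/\ 1 <= a < q, coprime a q & K (a%:R / q%:R)%R <= R - 1].
Proof.
case=> s /and4P[_ sR _ /andP[s_last _]] <-.
have s_gt0 : all (leq 1) s by apply: sub_all sR => n /andP[].
exists (cf_num s); split; first exact: cf_num_itv.
  exact: coprime_cf_num_den.
rewrite (K_is_cf (is_cf_num_den s_gt0 s_last)).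
by apply/bigmax_leqP_seq => n /(allP sR); lia.
Qed.

Definition squarefree n : Prop := forall d, d ^ 2 %| n -> d = 1.

Lemma squarefree_gt0 n : squarefree n -> 0 < n.
Proof. by case: n => // /(_ 0 isT). Qed.

Lemma squarefree_decomposition n : 0 < n ->
  exists x m, n = x * m ^ 2 /\ squarefree x.
Proof.
move=> n_gt0.
have ex_sqr : exists m, m ^ 2 %| n by exists 1.
have sqr_bound m : m ^ 2 %| n -> m <= n by move/(dvdn_leq n_gt0); nia.
case: (ex_maxnP ex_sqr sqr_bound) => m /dvdnP[x nE] m_max.
exists x, m; split=> // d /dvdnP[k xE].
have := m_max (d * m); rewrite nE xE expnMn -mulnA dvdn_mull // => /(_ isT).
by move: n_gt0; rewrite nE xE; nia.
Qed.

Lemma squarefree_pnat_dvdn n m : squarefree n -> \pi(m).-nat n -> n %| m.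
Proof.
move=> sqf n_pi; apply/dvdn_partP => [|p p_n]; first exact: squarefree_gt0.
have := pnatPpi n_pi p_n; rewrite mem_primes => /and3P[p_prime _ p_m].
rewrite p_part; apply: dvdn_trans p_m.
rewrite -[p in _ %| p]expn1 dvdn_exp2l //.
rewrite leqNgt -pfactor_dvdn ?squarefree_gt0 //.
by apply/negP => /sqf p1; rewrite p1 in p_prime.
Qed.

Lemma pnat_pi_dvdn p n m : prime p -> p %| n -> \pi(m).-nat n -> p %| m.
Proof.
by move=> p_prime p_n /(pnat_dvd p_n); rewrite pnatE // mem_primes => /and3P[].
Qed.

Lemma pnat_pi_expn p k n : prime p -> \pi(p ^ k).-nat n -> exists j, n = p ^ j.
Proof.
move=> p_prime n_pi; have [|j ->] := @p_natP p n; last by exists j.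
apply: sub_in_pnat n_pi => r _; rewrite mem_primes => /and3P[r_prime _].
by rewrite Euclid_dvdX // dvdn_prime2 // => /andP[].
Qed.

Lemma radn_gt0 n : 0 < radn n.
Proof.
rewrite /radn big_seq prodn_cond_gt0 // => p.
by rewrite mem_primes => /andP[/prime_gt0].
Qed.

Lemma pnat_pi_radn n : 0 < n -> \pi(radn n).-nat n.
Proof.
move=> n_gt0; apply/pnatP => // p p_prime p_n.
have p_primes : p \in primes n by rewrite mem_primes p_prime n_gt0.
by rewrite mem_primes p_prime radn_gt0 /radn (big_rem p) //= dvdn_mulr.
Qed.

Lemma radn_gt4 n : 1 < n -> (forall k, 0 < k -> n <> 2 ^ k) ->
  (forall k, 0 < k -> n <> 3 ^ k) -> 4 < radn n.
Proof.
move=> n_gt1 not_pow2 not_pow3.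
have not_pow p : prime p -> (forall k, 0 < k -> n <> p ^ k) ->
    forall k, radn n <> p ^ k.
  move=> p_prime not_powp k radE.
  have := pnat_pi_radn (ltnW n_gt1); rewrite radE => /(pnat_pi_expn p_prime).
  by case=> -[n1|j /not_powp]; [rewrite n1 in n_gt1 | apply].
have := not_pow 2 isT not_pow2; have := not_pow 3 isT not_pow3.
case: (radn n) (radn_gt0 n) => [|[|[|[|[|r]]]]] // _.
- by move=> /(_ 0).
- by move=> _ /(_ 1).
- by move=> /(_ 1).
- by move=> _ /(_ 2).
Qed.

Lemma admissible_den_squarefree R q : squarefree q -> 4 < q <= R -> q != 6 ->
  admissible_den R q.
Proof.
move=> sqf /andP[q_gt4 q_leR] q_neq6.
have q_mod4 : ~~ (4 %| q) by apply/negP => /(sqf 2).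
have [->|q_neq10] := eqVneq q 10.
  by exists [:: 3; 3]; rewrite // /admissible /=; lia.
have [q_odd|q_even] := boolP (odd q).
  by exists [:: q./2; 2]; rewrite /admissible /cf_den /=; lia.
have [q_mod8|q_mod8] := eqVneq (q %% 8) 6.
  by exists [:: 2; q %/ 8; 4]; rewrite /admissible /cf_den /=; lia.
by exists [:: 2; (q %/ 8).-1; 1; 3]; rewrite /admissible /cf_den /=; lia.
Qed.

Lemma admissible_den_sqr R m : 5 < R -> m \in [:: 3; 4; 6] ->
  admissible_den R (m ^ 2).
Proof.
move=> R_gt5; rewrite !inE => /or3P[] /eqP->.
- by exists [:: 4; 2]; rewrite /admissible /cf_den /=; lia.
- by exists [:: 2; 3; 2]; rewrite /admissible /cf_den /=; lia.
- by exists [:: 3; 3; 1; 2]; rewrite /admissible /cf_den /=; lia.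
Qed.

Lemma admissible_den_mul4 R x : 4 < R -> 1 < x <= R ->
  admissible_den R (x * 2 ^ 2).
Proof.
move=> R_gt4 x_itv.
by exists [:: 2; x.-1; 2]; rewrite /admissible /cf_den /=; lia.
Qed.

(* Folding [[:: 6]] would start with the quotient [6], too large for [R = 6]. *)
Lemma admissible_den6_mul36 x : x %| 6 -> 1 < x -> admissible_den 6 (x * 6 ^ 2).
Proof.
rewrite dvdn_divisors // !inE => /or4P[] /eqP-> // _.
- by exists [:: 4; 4; 4].
- by exists [:: 4; 1; 2; 3; 2].
- by exists [:: 4; 2; 2; 4; 2].
Qed.

Lemma admissible_den_mul_sqr R x m : 4 < R -> x %| R -> 0 < x ->
  \pi(R).-nat m -> m \in [:: 2; 3; 4; 6] -> x * m ^ 2 != 4 ->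
  admissible_den R (x * m ^ 2).
Proof.
move=> R_gt4 x_R x_gt0 m_pi m_small q_neq4.
have x_leR : x <= R by rewrite dvdn_leq //; lia.
have R_even : 2 %| m -> 2 %| R by move/pnat_pi_dvdn; apply.
have R_mul3 : 3 %| m -> 3 %| R by move/pnat_pi_dvdn; apply.
have [mE|m_neq2] := eqVneq m 2.
  by rewrite mE in q_neq4 *; apply: admissible_den_mul4; lia.
have m_346 : m \in [:: 3; 4; 6] by move: m_small; rewrite inE (negPf m_neq2).
have R_gt5 : 5 < R.
  have : (2 %| m) || (3 %| m) by move: m_346; rewrite !inE => /or3P[] /eqP->.
  by case/orP => [/R_even|/R_mul3]; lia.
have [->|x_neq1] := eqVneq x 1.
  by rewrite mul1n; apply: admissible_den_sqr.
have [/andP[/eqP mE /eqP RE]|not_both6] := boolP ((m == 6) && (R == 6)).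
  by rewrite mE RE in x_R *; apply: admissible_den6_mul36; lia.
apply: admissible_den_fold1; first lia.
by move: m_346; rewrite !inE; lia.
Qed.

Lemma admissible_den_pnat R q : 4 < R -> \pi(R).-nat q ->
  q \notin [:: 1; 2; 3; 4; 6] -> admissible_den R q.
Proof.
move=> R_gt4; elim/ltn_ind: q => q IH q_pi q_big.
have /andP[q_gt0 _] := q_pi.
have [x [m [qE sqf]]] := squarefree_decomposition q_gt0.
have x_gt0 := squarefree_gt0 sqf.
have [x_pi m_pi] : \pi(R).-nat x /\ \pi(R).-nat m.
  by move: q_pi; rewrite qE pnatM pnatX orbF => /andP.
have x_R := squarefree_pnat_dvdn sqf x_pi.
have x_leR : x <= R by rewrite dvdn_leq //; lia.
have [m1|m_neq1] := eqVneq m 1.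
  have xE : x = q by rewrite qE m1 muln1.
  rewrite xE in sqf x_leR; apply: admissible_den_squarefree => //.
    by move: q_big; rewrite !inE; lia.
  by apply: contra q_big => /eqP->.
rewrite qE in q_big *; have [m_small|m_big] := boolP (m \in [:: 2; 3; 4; 6]).
  by apply: admissible_den_mul_sqr => //; apply: contra q_big => /eqP->.
apply: admissible_den_fold; first by rewrite x_gt0.
apply: IH => //; last by rewrite inE negb_or m_neq1.
nia.
Qed.

Local Open Scope ring_scope.

Theorem theorem2 (q : nat) (hq : (2 <= q)%N)
    (h2 : forall n : nat, (0 < n)%N -> q <> (2 ^ n)%N)
    (h3 : forall n : nat, (0 < n)%N -> q <> (3 ^ n)%N) :
  exists a : nat,
    [/\ (1 <= a < q)%N, coprime a q & (K (a%:R / q%:R) <= radn q - 1)%N].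
Proof.
have [->|q_neq6] := eqVneq q 6%N.
  exists 5%N; split=> //; rewrite (@K_is_cf _ [:: 1; 5]%N) //.
  by rewrite /radn /= !big_cons !big_nil.
apply/K_admissible_den/admissible_den_pnat; first exact: radn_gt4.
  by apply: pnat_pi_radn; apply: ltnW.
rewrite !inE (negPf q_neq6) orbF; apply/negP => /or4P[] /eqP qE.
- by rewrite qE in hq.
- exact: (h2 1%N).
- exact: (h3 1%N).
- exact: (h2 2%N).
Qed.
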